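(* Let $n\ge1$ be an integer, let $\mathcal{P}_n\subset\mathbb{R}^n$ be the convex hull of all parking functions of length $n$, and for an integer $S$ let $\mathcal{P}_{n,S}$ be the set of points $x\in\mathcal{P}_n$ satisfying $x_1+\dots+x_n=S$. For each integer $S$ with $n+1\le S\le \frac{n(n+1)}{2}$ there is a unique pair of positive integers $(r,k)$ such that $k\le n-1$, $2\le r\le k+1$, $$\underbrace{1+\dots+1}_{k\text{ ones}}+r+(k+2)+(k+3)+\dots+n=S,$$ and, for this pair, the set of vertices of $\mathcal{P}_{n,S}$ is the set of permutations (rearrangements of coordinates) of $$(\underbrace{1,\dots,1}_{k\text{ ones}},r,k+2,k+3,\dots,n).$$ For $S=n$, the set of vertices of $\mathcal{P}_{n,n}$ consists of the single point $(1,\dots,1)$.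
   Context: A sequence $\alpha=(a_1,\dots,a_n)$ with $a_i\in\{1,\dots,n\}$ is a parking function of length $n$ if its weakly increasing rearrangement $b_1\le b_2\le\dots\le b_n$ satisfies $b_i\le i$ for all $i\in\{1,\dots,n\}$. When $k=n-1$ the sum $(k+2)+\dots+n$ is empty (equal to $0$), and the vector is $(1,\dots,1,r)$ with $n-1$ ones. A vertex of a polytope is a $0$-dimensional face. *)

(* Defs.v *)
From HB Require Import structures.
From mathcomp Require Import all_boot all_order all_algebra.
From mathcomp Require Import perm classical_sets reals convex.

Set Implicit Arguments.
Unset Strict Implicit.
Unset Printing Implicit Defensive.

Import Order.TTheory GRing.Theory Num.Theory.

Local Open Scope classical_set_scope.
Local Open Scope ring_scope.

Definition parking_function (n : nat) (a : n.-tuple nat) : bool :=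
  all (fun x => (1 <= x <= n)%N) a &&
  [forall i : 'I_n, (nth 0%N (sort leq a) i <= i.+1)%N].

Definition row_of_seq (R : realType) (n : nat) (s : seq nat) : 'rV[R]_n :=
  \row_(i < n) (nth 0%N s i)%:R.

Definition convex_hull (R : realType) (n : nat) (A : set 'rV[R]_n) :
    set 'rV[R]_n :=
  smallest (@convex_set R 'rV[R]_n) A.

Definition parking_polytope (R : realType) (n : nat) : set 'rV[R]_n :=
  convex_hull
    [set row_of_seq R n (tval a) | a in [set a : n.-tuple nat | parking_function a]].
Arguments parking_polytope : clear implicits.

Definition parking_slice (R : realType) (n : nat) (S : int) : set 'rV[R]_n :=
  [set x | parking_polytope R n x /\ \sum_(i < n) x 0 i = S%:~R].
Arguments parking_slice : clear implicits.

Definition affine_subspace (R : realType) (n d : nat) (L : set 'rV[R]_n) : Prop :=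
  exists (p : 'rV[R]_n) (U : {vspace 'rV[R]_n}),
    \dim U = d /\ L = [set p + u | u in [set` U]].

Definition affine_hull (R : realType) (n : nat) (A : set 'rV[R]_n) :
    set 'rV[R]_n :=
  smallest (fun L => exists d, affine_subspace d L) A.

(* The empty set has no dimension here (usually it is given dimension -1). *)
Definition has_dim (R : realType) (n : nat) (A : set 'rV[R]_n) (d : nat) : Prop :=
  A !=set0 /\ affine_subspace d (affine_hull A).

(* c = 0 yields the improper faces: P itself (b = 0) and the empty set (b > 0). *)
Definition face (R : realType) (n : nat) (P F : set 'rV[R]_n) : Prop :=
  exists (c : 'rV[R]_n) (b : R),
    (forall x, P x -> \sum_(i < n) c 0 i * x 0 i <= b) /\
    F = [set x | P x /\ \sum_(i < n) c 0 i * x 0 i = b].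

Definition vertices (R : realType) (n : nat) (P : set 'rV[R]_n) : set 'rV[R]_n :=
  [set v | exists F, [/\ face P F, has_dim F 0 & F v]].

Definition admissible (n : nat) (S : int) (r k : nat) : Prop :=
  [/\ (0 < r)%N, (0 < k)%N, (k <= n - 1)%N, (2 <= r <= k + 1)%N &
      (\sum_(i < k) 1 + r + \sum_(k + 2 <= i < n.+1) i)%N%:Z = S].

(* (1, ..., 1, r, k + 2, k + 3, ..., n), of length n when k < n. *)
Definition vertex_seq (n r k : nat) : seq nat :=
  nseq k 1%N ++ r :: iota (k + 2) (n - (k + 1)).

Definition rearrangements (R : realType) (n : nat) (v : 'rV[R]_n) :
    set 'rV[R]_n :=
  [set w | exists s : 'S_n, w = col_perm s v].

(* Main.v *)
(** Let [v] be the weakly increasing candidate vertex and [x] a point of the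
    slice. For every rearrangement of the coordinates of [x], each tail sum
    [x_j + ... + x_n] is at most the tail sum of [v]: beyond the ones of [v]
    this is the bound [j + ... + n], which holds for parking functions, and
    within the ones it follows from [x_i >= 1] and the fixed total [S]. By Abel
    summation every weakly increasing functional is maximised over the slice
    at [v], so every linear functional is maximised at some rearrangement of
    [v]; and the coefficients [0, 1, ..., n - 1] give a functional whose only
    maximiser is [v]. *)

Require Import Defs.
From HB Require Import structures.
From mathcomp Require Import all_boot all_order all_algebra.
From mathcomp Require Import perm classical_sets reals convex.
From mathcomp Require Import interval_inference zify lra.

Set Implicit Arguments.
Unset Strict Implicit.
Unset Printing Implicit Defensive.

Import Order.TTheory GRing.Theory Num.Theory.

Local Open Scope classical_set_scope.
Local Open Scope ring_scope.

(** * Arithmetic of the pair (r, k) *)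

Lemma nat_interval_sum_step (n k : nat) : (k.+1 < n)%N ->
  (k + 1 + \sum_(k + 2 <= i < n.+1) i =
   k.+1 + 1 + \sum_(k.+1 + 2 <= i < n.+1) i + k.+1)%N.
Proof.
move=> kn; rewrite big_ltn; last lia.
by rewrite -[(k + 2).+1]/(k.+1 + 2)%N; lia.
Qed.

(* [g k] is the sum of (1, ..., 1, r, k+2, ..., n) at [r = 1]. Since
   [g k = g (k + 1) + (k + 1)], the intervals (g k, g k + k] partition
   (n, n(n+1)/2]. *)
Lemma admissible_exists_unique (n : nat) (S : int) : (1 <= n)%N ->
  n%:Z + 1 <= S -> S <= ((n * (n + 1)) %/ 2)%N%:Z ->
  exists! rk : nat * nat, admissible n S rk.1 rk.2.
Proof.
move=> n_gt0 S_gt S_le; set g := fun k => (k + 1 + \sum_(k + 2 <= i < n.+1) i)%N.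
have gS k : (k.+1 < n)%N -> g k = (g k.+1 + k.+1)%N by exact: nat_interval_sum_step.
have gn : g n.-1 = n by rewrite /g big_geq; lia.
have g0 : g 0%N = ((n * (n + 1)) %/ 2)%N.
  have -> : g 0%N = (\sum_(0 <= i < n.+1) i)%N.
    by rewrite [RHS]big_ltn // [in RHS]big_ltn.
  elim: (n) => [|m IH]; first by rewrite big_nat1.
  by rewrite big_nat_recr //= IH; lia.
have adm r k : admissible n S r k <->
  [/\ (0 < k)%N, (k <= n - 1)%N, (2 <= r <= k + 1)%N & (g k + r)%N%:Z = S + 1].
  rewrite /admissible sum_nat_const card_ord muln1 /g; split.
    by case=> ? ? ? ? E; split=> //; lia.
  by case=> ? ? ? E; split=> //; lia.
have g_anti k k' : (k < k')%N -> (k' <= n - 1)%N -> (g k' + k' <= g k)%N.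
  elim: k' => // k' IH kk' k'n; have := gS k'.
  have [->|] := eqVneq k k'; first lia.
  by move=> neq; have := IH; lia.
(* Take the least [k] with [g k < S]. It is positive because [g 0] is n(n+1)/2, and minimality gives
   [S <= g (k - 1) = g k + k], which is the bound [r <= k + 1]. *)
have exk : exists k, ((g k)%:Z < S) by exists n.-1; lia.
case: (ex_minnP exk) => k Sk kmin.
have kn : (k <= n - 1)%N by rewrite subn1; apply: kmin; lia.
have k_gt0 : (0 < k)%N by case: (k) Sk => //; lia.
have Spred : S <= (g k.-1)%:Z.
  by rewrite leNgt; apply/negP => /kmin; lia.
have gk := gS k.-1; rewrite prednK // in gk.
(* [g k] already counts 1 in the place of [r], hence [r = S + 1 - g k]. *)
exists (`|S|.+1 - g k, k)%N; split.
  by apply/adm; split => //=; lia.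
case=> r' k' /adm [/= ? ? ? E].
have kk : k = k'.
  have [kk'|kk'|//] := ltngtP k k'; [have := g_anti _ _ kk' | have := g_anti _ _ kk']; lia.
by subst k'; congr (_, _); lia.
Qed.

(** * The candidate vertex as a sequence *)

Lemma nth_vertex_seq (n r k i : nat) : (k < n)%N -> (i < n)%N ->
  nth 0%N (vertex_seq n r k) i =
  if (i < k)%N then 1%N else if i == k then r else i.+1.
Proof.
move=> kn i_n; rewrite /vertex_seq nth_cat size_nseq nth_nseq.
case: ltnP => // ki; have [->|ik] := eqVneq i k; first by rewrite subnn.
have -> : (i - k = (i - k.+1).+1)%N by lia.
by rewrite /= nth_iota; lia.
Qed.

Lemma size_vertex_seq (n r k : nat) : (k < n)%N -> size (vertex_seq n r k) = n.
Proof. by move=> kn; rewrite size_cat size_nseq /= size_iota; lia. Qed.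

Lemma sum_vertex_seq (n r k : nat) : (k < n)%N ->
  (\sum_(i < n) nth 0 (vertex_seq n r k) i =
   \sum_(i < k) 1 + r + \sum_(k + 2 <= i < n.+1) i)%N.
Proof.
move=> kn; transitivity (sumn (vertex_seq n r k)).
  by rewrite sumnE (big_nth 0%N) size_vertex_seq // big_mkord.
rewrite sumn_cat sumn_nseq /= sum_nat_const card_ord mul1n muln1 -addnA.
by rewrite sumnE /index_iota; do 4 f_equal; lia.
Qed.

(** Since [1 <= r <= k + 1], the candidate is weakly increasing, so it is the sorted form of [a] and
    the defining bounds can be read off entry by entry. *)
Lemma vertex_seq_rearrangement_parking (n r k : nat) (a : n.-tuple nat) :
  (k < n)%N -> (1 <= r <= k + 1)%N -> perm_eq a (vertex_seq n r k) ->
  parking_function a.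
Proof.
move=> kn rk av; have sz := size_vertex_seq r kn.
have nthE i : (i < n)%N -> _ := nth_vertex_seq r kn.
have -> : parking_function a =
  all (fun x => (1 <= x <= n)%N) (vertex_seq n r k) &&
  [forall i : 'I_n, (nth 0%N (vertex_seq n r k) i <= i.+1)%N].
  rewrite /parking_function (perm_all _ av); congr (_ && _).
  suff -> : sort leq a = vertex_seq n r k by [].
  apply: (sorted_eq leq_trans anti_leq) (sort_sorted leq_total _) _ _.
    apply/(sortedP 0%N) => i; rewrite sz => i_n.
    by rewrite !nthE ?(ltnW i_n) //; do !case: ifP; lia.
  by rewrite perm_sort.
apply/andP; split; last by apply/forallP => i; rewrite nthE //; do !case: ifP; lia.
by apply/(all_nthP 0%N) => i; rewrite sz => i_n; rewrite nthE //; do !case: ifP; lia.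
Qed.

(** * Linear inequalities on the parking polytope *)

(** Each entry is at most [j] plus its truncated excess over [j]. The total excess over all
    positions does not depend on their order, so it can be bounded on the sorted sequence, where the
    excess at [i] is at most [i.+1 - j]. *)
Lemma parking_function_tail_sum (n : nat) (a : n.-tuple nat) (s : 'S_n) (j : nat) :
  parking_function a ->
  (\sum_(i < n | j <= i) nth 0 a (s i) <= \sum_(i < n | j <= i) i.+1)%N.
Proof.
case/andP=> _ /forallP a_le.
have excess : (\sum_(i < n) (nth 0 a (s i) - j) <= \sum_(i < n) (i.+1 - j))%N.
  rewrite -(reindex_inj (perm_inj (s := s)) (P := xpredT)
              (F := fun i : 'I_n => nth 0 a i - j)%N) /=.
  have -> : (\sum_(i < n) (nth 0 a i - j) = \sum_(x <- a) (x - j))%N.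
    by rewrite (big_nth 0%N) size_tuple big_mkord.
  rewrite -(perm_big _ (permEl (perm_sort leq a))) (big_nth 0%N).
  rewrite size_sort size_tuple big_mkord.
  by apply: leq_sum => i _; apply: leq_sub2r.
have -> : (\sum_(i < n | j <= i) i.+1 =
           \sum_(i < n | j <= i) j + \sum_(i < n) (i.+1 - j))%N.
  rewrite [X in (_ + X)%N](bigID (fun i : 'I_n => j <= i)%N) /=.
  rewrite [X in (_ + (_ + X))%N]big1 ?addn0; last by move=> i; lia.
  by rewrite -big_split /=; apply: eq_bigr => i ji; lia.
apply: (@leq_trans (\sum_(i < n | j <= i) (j + (nth 0 a (s i) - j)))%N).
  by apply: leq_sum => i _; lia.
rewrite big_split leq_add2l /=; apply: leq_trans excess.
by rewrite [leqRHS](bigID (fun i : 'I_n => j <= i)%N) /= leq_addr.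
Qed.

(** A closed half-space is convex, so it contains the hull of any set it contains. *)
Lemma convex_hull_le (R : realType) (n : nat) (A : set 'rV[R]_n) (c : 'I_n -> R)
    (b : R) (x : 'rV[R]_n) :
  (forall a, A a -> \sum_(i < n) c i * a 0 i <= b) ->
  convex_hull A x -> \sum_(i < n) c i * x 0 i <= b.
Proof.
move=> Ab; suff : convex_hull A `<=` [set y | \sum_(i < n) c i * y 0 i <= b] by apply.
apply: smallest_sub => //.
move=> y z l /[!inE] /= yb zb.
have -> : \sum_(i < n) c i * (conv l y z : 'rV[R]_n) 0 i =
    l%:num * (\sum_(i < n) c i * y 0 i) + (1 - l%:num) * \sum_(i < n) c i * z 0 i.
  rewrite !mulr_sumr -big_split /=; apply: eq_bigr => i _.
  by rewrite !mxE mulrDr !mulrA ![c i * _]mulrC.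
have l0 : 0 <= l%:num by [].
have l1 : l%:num <= 1 by [].
nra.
Qed.

Lemma parking_polytope_ge1 (R : realType) (n : nat) (x : 'rV[R]_n) (j : 'I_n) :
  parking_polytope R n x -> 1 <= x 0 j.
Proof.
have E (y : 'rV[R]_n) : \sum_(i < n) - (i == j)%:R * y 0 i = - y 0 j.
  rewrite (bigD1 j) //= eqxx mulN1r big1 ?addr0 // => i /negPf ->.
  by rewrite oppr0 mul0r.
rewrite -lerN2 -E; apply: convex_hull_le => _ [a /andP[a1 _] <-].
rewrite E lerN2 mxE ler1n.
by have /allP/(_ (nth 0%N a j)) := a1; rewrite mem_nth ?size_tuple // => /(_ isT)/andP[].
Qed.

Lemma parking_polytope_tail_sum (R : realType) (n : nat) (x : 'rV[R]_n)
    (s : 'S_n) (j : nat) : parking_polytope R n x ->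
  \sum_(i < n | (j <= i)%N) x 0 (s i) <= \sum_(i < n | (j <= i)%N) (i.+1)%:R.
Proof.
(* The permuted tail sum is a linear functional with 0/1 coefficients, so its bound passes from
   parking functions to their hull. *)
have E (y : 'rV[R]_n) : \sum_(i < n | (j <= i)%N) y 0 (s i) =
    \sum_(i < n) (j <= (s^-1)%g i)%:R * y 0 i.
  rewrite [RHS](reindex_inj (perm_inj (s := s))) /= [LHS]big_mkcond /=.
  by apply: eq_bigr => i _; rewrite permK; case: ifP; rewrite ?mul1r ?mul0r.
rewrite E; apply: convex_hull_le => _ [a aP <-]; rewrite -E.
under eq_bigr do rewrite mxE.
by rewrite -!natr_sum ler_nat parking_function_tail_sum.
Qed.

(** * Tail sums and monotone functionals *)

(* Abel summation. *)
Lemma monotone_sum_ge (R : realType) (n : nat) (c d : 'I_n.+1 -> R) :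
  (forall i j : 'I_n.+1, (i <= j)%N -> c i <= c j) ->
  (forall j : nat, (0 < j)%N -> 0 <= \sum_(i < n.+1 | (j <= i)%N) d i) ->
  c ord0 * (\sum_(i < n.+1) d i) <= \sum_(i < n.+1) c i * d i.
Proof.
elim: n c d => [|n IH] c d c_mono d_tail; first by rewrite !big_ord_recl !big_ord0 !addr0.
have tailS j : \sum_(i < n.+2 | (j < i)%N) d i =
    \sum_(i < n.+1 | (j <= i)%N) d (lift ord0 i).
  by rewrite big_mkcond big_ord_recl /= add0r -big_mkcond.
rewrite [in leRHS]big_ord_recl [in leLHS]big_ord_recl mulrDr lerD2l.
(* Raising the factor from the first coefficient to the second cannot decrease the product, since
   the remaining sum is the tail from 1, which is nonnegative. *)
apply: (@le_trans _ _ (c (lift ord0 ord0) * \sum_(i < n.+1) d (lift ord0 i))).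
  have := d_tail 1%N isT; rewrite tailS /= => tail1.
  by apply: ler_wpM2r => //; apply: c_mono.
apply: (IH (fun i => c (lift ord0 i)) (fun i => d (lift ord0 i))).
  by move=> i j ij; apply: c_mono.
by move=> j j_gt0; rewrite -tailS d_tail.
Qed.

Lemma monotone_sum_le (R : realType) (n : nat) (c x v : 'I_n -> R) :
  (forall i j : 'I_n, (i <= j)%N -> c i <= c j) ->
  (forall j : nat,
     \sum_(i < n | (j <= i)%N) x i <= \sum_(i < n | (j <= i)%N) v i) ->
  \sum_(i < n) x i = \sum_(i < n) v i ->
  \sum_(i < n) c i * x i <= \sum_(i < n) c i * v i.
Proof.
case: n c x v => [|n] c x v c_mono tails total; first by rewrite !big_ord0.
rewrite -subr_ge0 -sumrB; under eq_bigr do rewrite -mulrBr.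
have := @monotone_sum_ge R n c (fun i => v i - x i) c_mono.
rewrite sumrB total subrr mulr0; apply=> j _.
by rewrite sumrB subr_ge0.
Qed.

(** Double counting: the index-weighted sum of [v - x] is the sum of its tails from 1 to [n]. These
    are nonnegative with sum 0, so all vanish, and each entry is a difference of consecutive
    tails. *)
Lemma index_sum_eq (R : realType) (n : nat) (x v : 'I_n -> R) :
  (forall j : nat,
     \sum_(i < n | (j <= i)%N) x i <= \sum_(i < n | (j <= i)%N) v i) ->
  \sum_(i < n) x i = \sum_(i < n) v i ->
  \sum_(i < n) i%:R * x i = \sum_(i < n) i%:R * v i ->
  x =1 v.
Proof.
move=> tails total weighted.
pose t (j : nat) := \sum_(i < n | (j <= i)%N) (v i - x i).
have t_ge0 j : 0 <= t j by rewrite /t sumrB subr_ge0.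
have sum_t : \sum_(j < n) t j.+1 = 0.
  have -> : \sum_(j < n) t j.+1 = \sum_(i < n) i%:R * (v i - x i).
    rewrite (exchange_big_dep xpredT) //=; apply: eq_bigr => i _.
    rewrite sumr_const mulr_natl; congr (_ *+ _).
    rewrite -sum1_card (eq_bigl (fun j : 'I_n => j < i)%N) //.
    by rewrite -(big_ord_widen n (fun=> 1%N)) ?sum1_card ?card_ord // ltnW.
  by under eq_bigr do rewrite mulrBr; rewrite sumrB weighted subrr.
have t_eq0 (j : nat) : (j <= n)%N -> t j = 0.
  case: j => [_|j j_n]; first by rewrite /t sumrB total subrr.
  by have := psumr_eq0P (fun (j : 'I_n) _ => t_ge0 j.+1) sum_t (i := Ordinal j_n); apply.
move=> i; apply/eqP; rewrite eq_sym -subr_eq0; apply/eqP.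
rewrite -(t_eq0 i); last exact: ltnW.
rewrite /t (bigD1 i) //= (eq_bigl (fun l : 'I_n => i.+1 <= l)%N); last first.
  by move=> l; rewrite -val_eqE /= ltn_neqAle andbC eq_sym.
by rewrite -/(t i.+1) t_eq0 ?addr0.
Qed.

(** * Vertices as unique maximisers, and sorting of coefficients *)

(** The affine hull of a 0-dimensional face is a translate of the zero space, so the face is one
    point; conversely a singleton is affine and equals its own hull. *)
Lemma verticesP (R : realType) (n : nat) (P : set 'rV[R]_n) (v : 'rV[R]_n) :
  vertices P v <-> exists c : 'rV[R]_n, P v /\
    forall x, P x -> \sum_(i < n) c 0 i * x 0 i <= \sum_(i < n) c 0 i * v 0 i /\
      (\sum_(i < n) c 0 i * x 0 i = \sum_(i < n) c 0 i * v 0 i -> x = v).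
Proof.
split.
  move=> [F [[c [b [Pb FE]]] [_ [p [U [dimU hullE]]]] Fv]].
  have U0 : U = 0%VS by apply/eqP; rewrite -dimv_eq0 dimU.
  have hull_p x : F x -> x = p.
    move=> Fx; have : affine_hull F x by exact: sub_gen_smallest.
    by rewrite hullE U0 => -[u /=]; rewrite memv0 => /eqP -> <-; rewrite addr0.
  have [Pv vb] : P v /\ \sum_(i < n) c 0 i * v 0 i = b by move: Fv; rewrite FE.
  exists c; split=> // x Px; rewrite vb; split; first exact: Pb.
  by move=> xb; rewrite (hull_p v) // (hull_p x) // FE.
move=> [c [Pv vmax]]; exists [set v]; split=> //.
  exists c, (\sum_(i < n) c 0 i * v 0 i); split; first by move=> x /vmax[].
  apply/seteqP; split=> [x /= ->//|x /= [Px xv]].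
  by have [_ /(_ xv)] := vmax x Px.
have aff : affine_subspace 0 [set v].
  exists v, 0%VS; split; first by rewrite dimv0.
  apply/seteqP; split=> [x /= ->|x /= [u]].
    by exists 0; rewrite ?addr0 //= mem0v.
  by rewrite memv0 => /eqP -> <-; rewrite addr0.
split; first by exists v.
by rewrite /affine_hull smallest_id //; exists 0%N.
Qed.

Lemma sorting_perm (R : realType) (n : nat) (c : 'I_n -> R) :
  exists s : 'S_n, forall i j : 'I_n, (i <= j)%N -> c (s i) <= c (s j).
Proof.
pose t := [tuple c i | i < n].
have /tuple_permP[s sE] : perm_eq (sort <=%O t) t by rewrite perm_sort.
exists s => i j ij.
have nthE (l : 'I_n) : c (s l) = nth 0 (sort <=%O t) l.
  by rewrite sE -tnth_nth !tnth_mktuple.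
rewrite !nthE; apply: (sorted_leq_nth le_trans lexx) => //.
- exact: sort_le_sorted.
- by rewrite inE size_sort size_tuple.
- by rewrite inE size_sort size_tuple.
Qed.

(** * The vertices of a slice *)

Section Slice.
Variables (R : realType) (n r k : nat) (S : int).
Hypotheses (kn : (k < n)%N) (rk : (1 <= r <= k + 1)%N).
Hypothesis (sumS :
  (\sum_(i < k) 1 + r + \sum_(k + 2 <= i < n.+1) i)%N%:Z = S).

Let v := row_of_seq R n (vertex_seq n r k).

Let sum_v : \sum_(i < n) v 0 i = S%:~R.
Proof.
under eq_bigr do rewrite mxE.
by rewrite -natr_sum sum_vertex_seq // -sumS.
Qed.

Lemma rearrangement_in_slice (s : 'S_n) : parking_slice R n S (col_perm s v).
Proof.
split; last first.
  rewrite -sum_v [RHS](reindex_inj (perm_inj (s := s))) /=.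
  by apply: eq_bigr => i _; rewrite [LHS]mxE.
pose a := [tuple nth 0%N (vertex_seq n r k) (s i) | i < n].
apply: sub_gen_smallest; exists a.
  apply: (vertex_seq_rearrangement_parking kn rk).
  have sz : size (vertex_seq n r k) == n by rewrite size_vertex_seq.
  apply/(tuple_permP (t := Tuple sz)); exists s.
  by apply: (congr1 val); apply: eq_mktuple => i; rewrite (tnth_nth 0%N).
apply/rowP => i; rewrite !mxE; congr (_%:R).
by rewrite -tnth_nth tnth_mktuple.
Qed.

Lemma slice_tail_sum (x : 'rV[R]_n) (s : 'S_n) (j : nat) : parking_slice R n S x ->
  \sum_(i < n | (j <= i)%N) x 0 (s i) <= \sum_(i < n | (j <= i)%N) v 0 i.
Proof.
move=> [xP sum_x]; have [kj|jk] := ltnP k j.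
  apply: le_trans (parking_polytope_tail_sum s j xP) _.
  apply: ler_sum => i ji; rewrite mxE nth_vertex_seq //.
  by rewrite ifF ?ifF //; lia.
have split_sum (y : 'I_n -> R) : \sum_(i < n | (j <= i)%N) y i =
    \sum_(i < n) y i - \sum_(i < n | ~~ (j <= i)%N) y i.
  by rewrite [X in X - _](bigID (fun i : 'I_n => j <= i)%N) /= addrK.
(* With equal totals, it remains to compare the complementary sums in the reverse direction; there
   [i < j <= k], so [v] has entry 1. *)
rewrite !split_sum sum_v -sum_x [X in _ <= X - _](reindex_inj (perm_inj (s := s))) /=.
rewrite lerD2l lerN2; apply: ler_sum => i ij.
rewrite mxE nth_vertex_seq // ifT; last lia.
exact: parking_polytope_ge1.
Qed.

Lemma slice_total (x : 'rV[R]_n) (s : 'S_n) : parking_slice R n S x ->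
  \sum_(i < n) x 0 (s i) = \sum_(i < n) v 0 i.
Proof.
by case=> _; rewrite sum_v => <-; rewrite [RHS](reindex_inj (perm_inj (s := s))).
Qed.

Lemma vertices_slice : vertices (parking_slice R n S) = rearrangements v.
Proof.
apply/seteqP; split=> w.
  move=> /verticesP[c [wP wmax]].
  have [s s_mono] := sorting_perm (fun i => c 0 i).
  (* Permuting [v] by the inverse of [s] pairs its increasing entries with the increasing
     coefficients [c (s i)]. As [w] is the unique maximiser of [c], it suffices that this point does
     at least as well. *)
  exists (s^-1)%g; apply/esym.
  have v'P := rearrangement_in_slice (s^-1)%g.
  have [le_w] := wmax _ v'P; apply; apply/eqP; rewrite eq_le le_w /=.
  rewrite (reindex_inj (perm_inj (s := s))) [leRHS](reindex_inj (perm_inj (s := s))) /=.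
  have -> : \sum_i c 0 (s i) * col_perm (s^-1)%g v 0 (s i) = \sum_i c 0 (s i) * v 0 i.
    by apply: eq_bigr => i _; rewrite [col_perm _ _ _ _]mxE permK.
  apply: (monotone_sum_le (x := fun i => w 0 (s i))) => //.
    by move=> j; apply: slice_tail_sum.
  exact: slice_total.
(* Coordinate [i] of [col_perm s v] is [v 0 (s i)], so the coefficient [s i] gives each entry of [v]
   its own index as weight. *)
move=> [s ->]; apply/verticesP; exists (\row_i (s i)%:R).
split; first exact: rearrangement_in_slice.
move=> x xP.
have E (y : 'rV[R]_n) : \sum_i (\row_i (s i)%:R : 'rV[R]_n) 0 i * y 0 i =
    \sum_(i < n) i%:R * y 0 ((s^-1)%g i).
  rewrite [RHS](reindex_inj (perm_inj (s := s))) /=.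
  by apply: eq_bigr => i _; rewrite mxE permK.
rewrite !E.
have -> : \sum_(i < n) i%:R * col_perm s v 0 ((s^-1)%g i) = \sum_(i < n) i%:R * v 0 i.
  by apply: eq_bigr => i _; rewrite [col_perm _ _ _ _]mxE permKV.
have tails j := slice_tail_sum (s^-1)%g j xP.
have total := slice_total (s^-1)%g xP.
split.
  apply: (monotone_sum_le (x := fun i => x 0 ((s^-1)%g i))) => //.
  by move=> i j ij; rewrite ler_nat.
move=> /(index_sum_eq tails total) xv.
by apply/rowP => i; rewrite [RHS]mxE -xv permK.
Qed.

End Slice.

Theorem proposition5p1 (R : realType) (n : nat) (hn : (1 <= n)%N) :
  (forall S : int,
     n%:Z + 1 <= S -> S <= ((n * (n + 1)) %/ 2)%N%:Z ->
     (exists! rk : nat * nat, admissible n S rk.1 rk.2) /\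
     (forall r k : nat, admissible n S r k ->
        vertices (parking_slice R n S) =
        rearrangements (row_of_seq R n (vertex_seq n r k)))) /\
  vertices (parking_slice R n n%:Z) = [set const_mx 1].
Proof.
split.
  move=> S S_gt S_le; split; first exact: admissible_exists_unique.
  by move=> r k [r_gt0 k_gt0 kn /andP[r2 rk] sumS]; apply: vertices_slice => //; lia.
(* The sum [n] is the case [r = 1], [k = n - 1], which the bound [1 <= r] of the section admits. *)
have n1 : (n.-1 < n)%N by rewrite prednK.
have sum_n : (\sum_(i < n.-1) 1 + 1 + \sum_(n.-1 + 2 <= i < n.+1) i)%N%:Z = n%:Z.
  by rewrite sum_nat_const card_ord big_geq; lia.
rewrite (vertices_slice R n1 _ sum_n); last lia.
have -> : row_of_seq R n (vertex_seq n 1 n.-1) = const_mx 1.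
  apply/rowP => i; rewrite !mxE nth_vertex_seq //; case: ifP => //.
  by have := ltn_ord i; case: eqP => //; lia.
have perm_ones (s : 'S_n) : col_perm s (const_mx 1 : 'rV[R]_n) = const_mx 1.
  by apply/rowP => i; rewrite !mxE.
apply/seteqP; split=> [w [s ->]|w ->]; first exact: perm_ones.
by exists 1%g; rewrite perm_ones.
Qed.
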